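(* Let $n\ge 1$ and let $\Delta=(\Delta_{ij})$ be an integer $n\times n$ matrix such that $\det\Delta\neq 0$, $\Delta_{ij}\le 0$ for all $i\ne j$, and there exists a vector $\mathbf r\in\mathbb Z^n$ with $\mathbf r>0$ and $\mathbf r\Delta\ge 0$. Then for any $\mathbf r,\mathbf r'\in\mathscr R(\Delta)$, $\mathcal R(\Delta,\mathbf r)=\mathcal R(\Delta,\mathbf r')$.
   Context: Vectors are row vectors. $\mathbf r>0$ means $r_i>0$ for all $i$; $\mathbf r\ge \mathbf r'$ means $r_i\ge r'_i$ for all $i$. $\mathscr R(\Delta)=\{\mathbf r\in\mathbb Z^n : \mathbf r>0,\ \mathbf r\Delta\ge 0\}$. $\Delta_i$ is the $i$-th row of $\Delta$. A configuration is a row vector $\mathbf u\in\mathbb Z^n$ with $u_i\ge 0$ for all $i$. A vertex $i\in\{1,\dots,n\}$ is critical for $\mathbf u$ if $u_i\ge\Delta_{ii}$; $\mathbf u$ is stable if no vertex is critical, i.e. $0\le u_i<\Delta_{ii}$ for all $i$. Toppling a critical vertex $i$ replaces $\mathbf u$ by $\mathbf u-\Delta_i$. A sequence of topplings from $\mathbf u$ is a sequence $i_1,\dots,i_k$ such that $i_j$ is critical for $\mathbf u-\Delta_{i_1}-\cdots-\Delta_{i_{j-1}}$ for each $1\le j\le k$; it transforms $\mathbf u$ into $\mathbf u-\sum_{j=1}^k\Delta_{i_j}$. For $\mathbf r\in\mathscr R(\Delta)$, a $(\Delta,\mathbf r)$-recurrent configuration is a stable configuration $\mathbf u$ such that $\mathbf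 u+\mathbf r\Delta$ can be transformed into $\mathbf u$ by a sequence of topplings. $\mathcal R(\Delta,\mathbf r)$ is the set of $(\Delta,\mathbf r)$-recurrent configurations. *)

(* Defs.v *)
From mathcomp Require Import all_boot all_order all_algebra.
From mathcomp Require Import classical_sets.

Set Implicit Arguments.
Unset Strict Implicit.
Unset Printing Implicit Defensive.

Import Order.TTheory GRing.Theory Num.Theory.
Local Open Scope ring_scope.
Local Open Scope classical_set_scope.

Definition vpos n (r : 'rV[int]_n) : Prop := forall i : 'I_n, 0 < r 0 i.

Definition vnonneg n (r : 'rV[int]_n) : Prop := forall i : 'I_n, 0 <= r 0 i.

(* The set written \mathscr R(Delta); vectors are row vectors, so r Delta is
   r *m Delta. *)
Definition scriptR n (Delta : 'M[int]_n) : set 'rV[int]_n :=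
  [set r | vpos r /\ vnonneg (r *m Delta)].

Definition configuration n (u : 'rV[int]_n) : Prop := vnonneg u.

Definition critical n (Delta : 'M[int]_n) (u : 'rV[int]_n) (i : 'I_n) : bool :=
  Delta i i <= u 0 i.

Definition stable n (Delta : 'M[int]_n) (u : 'rV[int]_n) : Prop :=
  configuration u /\ forall i : 'I_n, ~~ critical Delta u i.

Definition topple n (Delta : 'M[int]_n) (u : 'rV[int]_n) (i : 'I_n)
    : 'rV[int]_n :=
  u - row i Delta.

(* Criticality is required at the configuration reached just before each
   toppling. *)
Fixpoint toppling_seq n (Delta : 'M[int]_n) (u : 'rV[int]_n) (s : seq 'I_n)
    : bool :=
  if s is i :: s' then
    critical Delta u i && toppling_seq Delta (topple Delta u i) s'
  else true.

Definition transforms n (Delta : 'M[int]_n) (u v : 'rV[int]_n) : Prop :=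
  exists2 s : seq 'I_n,
    toppling_seq Delta u s & v = u - \sum_(i <- s) row i Delta.

(* The set written \mathcal R(Delta, r). *)
Definition recurrent n (Delta : 'M[int]_n) (r : 'rV[int]_n)
    : set 'rV[int]_n :=
  [set u | stable Delta u /\ transforms Delta (u + r *m Delta) u].

(* Main.v *)
(** By the least action principle, a legal toppling sequence from [u] never
    topples more often than a nonnegative vector [z] for which [u - z Delta]
    lies below the diagonal of [Delta].  Hence a stable [u] is [r]-recurrent iff
    no nonzero [0 <= w <= r] brings [u + w Delta] below the diagonal.  Repeating
    the topplings shows that an [r]-recurrent [u] is also reached from
    [u + k r Delta] for every [k], so no nonzero [0 <= w <= k r] brings
    [u + w Delta] below the diagonal; a [k] with [r' <= k r] gives
    [r']-recurrence. *)
Require Import Defs.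
From mathcomp Require Import all_boot all_order all_algebra.
From mathcomp Require Import classical_sets.
From mathcomp Require Import zify.
Import Order.TTheory GRing.Theory Num.Theory.
Local Open Scope ring_scope.
Local Open Scope classical_set_scope.

Definition script {n} (s : seq 'I_n) : 'rV[int]_n :=
  \sum_(i <- s) delta_mx 0 i.

(** Only the upper half of stability: vectors such as [u - z *m Delta] may have negative entries,
    and the least action principle does not mind. *)
Definition below_diag {n} (Delta : 'M[int]_n) (u : 'rV[int]_n) : Prop :=
  forall i, u 0 i < Delta i i.

Definition Zmatrix {n} (Delta : 'M[int]_n) : Prop :=
  forall i j : 'I_n, i != j -> Delta i j <= 0.

Lemma script_mul {n} (Delta : 'M[int]_n) (s : seq 'I_n) :
  script s *m Delta = \sum_(i <- s) row i Delta.
Proof.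
by rewrite /script mulmx_suml; apply: eq_bigr => i _; rewrite rowE.
Qed.

(** Over the integers [Delta] need not be invertible; multiplying by the adjugate leaves the scalar
    [\det Delta], which cancels entrywise. *)
Lemma mulmx_row_inj {n} (Delta : 'M[int]_n) (x y : 'rV[int]_n) :
  \det Delta != 0 -> x *m Delta = y *m Delta -> x = y.
Proof.
move=> hdet /(congr1 (mulmx^~ (\adj Delta))).
rewrite -!mulmxA mul_mx_adj !mul_mx_scalar => h.
apply/rowP => i; move/rowP/(_ i): h; rewrite !mxE.
exact: mulfI.
Qed.

Lemma toppling_seq_add {n} (Delta : 'M[int]_n) (u v : 'rV[int]_n) s :
  vnonneg v -> toppling_seq Delta u s -> toppling_seq Delta (u + v) s.
Proof.
move=> v0; elim: s u => //= i s IHs u /andP[ci hs]; apply/andP; split.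
  by rewrite /critical !mxE (le_trans ci) // lerDl.
by rewrite /topple addrAC IHs.
Qed.

Lemma toppling_seq_cat {n} (Delta : 'M[int]_n) (u : 'rV[int]_n) s t :
  toppling_seq Delta u (s ++ t) =
  toppling_seq Delta u s &&
  toppling_seq Delta (u - \sum_(i <- s) row i Delta) t.
Proof.
elim: s u => [|i s IHs] u /=; first by rewrite big_nil subr0.
by rewrite IHs andbA big_cons opprD addrA.
Qed.

Lemma transforms_add {n} (Delta : 'M[int]_n) (u v w : 'rV[int]_n) :
  vnonneg w -> transforms Delta u v -> transforms Delta (u + w) (v + w).
Proof.
move=> w0 [s hs ->]; exists s; first exact: toppling_seq_add.
by rewrite addrAC.
Qed.

Lemma transforms_trans {n} (Delta : 'M[int]_n) (u v w : 'rV[int]_n) :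
  transforms Delta u v -> transforms Delta v w -> transforms Delta u w.
Proof.
move=> [s hs ->] [t ht ->]; exists (s ++ t).
  by rewrite toppling_seq_cat hs.
by rewrite big_cat opprD addrA.
Qed.

Lemma transforms_muln {n} (Delta : 'M[int]_n) (u v : 'rV[int]_n) k :
  vnonneg v -> transforms Delta (u + v) u -> transforms Delta (u + v *+ k) u.
Proof.
move=> v0 huv; elim: k => [|k IHk].
  by exists [::]; rewrite // big_nil mulr0n addr0 subr0.
(* The given sequence clears one copy of [v] while the other [k] copies ride along. *)
apply: transforms_trans IHk; rewrite mulrS addrA.
by apply: transforms_add => // i; rewrite mulmxnE mulrn_wge0.
Qed.

(* At a vertex [i] with [z_i = 0], firing [z] can only increase the entry. *)
Lemma critical_fired {n} {Delta : 'M[int]_n} {u z : 'rV[int]_n} {i : 'I_n} :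
  Zmatrix Delta -> vnonneg z -> below_diag Delta (u - z *m Delta) ->
  critical Delta u i -> vnonneg (z - delta_mx 0 i).
Proof.
move=> hoff z0 hz ci j; rewrite !mxE eqxx /=.
case: eqVneq => [->|_]; last by rewrite subr0.
rewrite subr_ge0 -gtz0_ge1 lt_neqAle z0 andbT eq_sym.
apply: contraTneq ci => zi0; rewrite /critical -ltNge.
apply: le_lt_trans (hz i); rewrite !mxE lerDl oppr_ge0.
apply: sumr_le0 => k _; have [->|ki] := eqVneq k i; first by rewrite zi0 mul0r.
by rewrite mulr_ge0_le0 // hoff.
Qed.

(** The invariant of the two inductions below: charging a toppling at [i] to [z] leaves the end
    point unchanged. *)
Lemma topple_fire {n} (Delta : 'M[int]_n) (u z : 'rV[int]_n) (i : 'I_n) :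
  topple Delta u i - (z - delta_mx 0 i) *m Delta = u - z *m Delta.
Proof. by rewrite /topple mulmxBl -rowE opprB addrA subrK. Qed.

Lemma least_action {n} {Delta : 'M[int]_n} {u z : 'rV[int]_n} {s} :
  Zmatrix Delta -> vnonneg z -> below_diag Delta (u - z *m Delta) ->
  toppling_seq Delta u s -> vnonneg (z - script s).
Proof.
move=> hoff; elim: s u z => [|i s IHs] u z z0 hz /=.
  by rewrite /script big_nil subr0.
case/andP=> ci hs; rewrite /script big_cons opprD addrA.
apply: (IHs (topple Delta u i)) => //; first exact: critical_fired ci.
by rewrite topple_fire.
Qed.

(** Greedy toppling stops: each legal toppling uses up one unit of [z], which stays nonnegative, so
    the entry sum of [z] bounds the length. *)
Lemma stabilization_exists {n} {Delta : 'M[int]_n} {u z : 'rV[int]_n} :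
  Zmatrix Delta -> vnonneg z -> below_diag Delta (u - z *m Delta) ->
  exists2 s, toppling_seq Delta u s & below_diag Delta (u - script s *m Delta).
Proof.
move=> hoff; have [m] : exists m : nat, \sum_i z 0%R i < m%:Z.
  by exists (absz (\sum_i z 0 i)).+1; lia.
elim: m u z => [|m IHm] u z hm z0 hz.
  by move: hm; rewrite ltNge sumr_ge0.
have [/existsP[i ci]|/existsPn hu] := boolP [exists i, critical Delta u i];
  last first.
  exists [::] => // i; rewrite /script big_nil mul0mx subr0 ltNge.
  exact: hu.
have zi0 := critical_fired hoff z0 hz ci.
have [||s hs hb] := IHm (topple Delta u i) _ _ zi0.
- have -> : \sum_j (z - delta_mx 0 i) 0 j = \sum_j z 0 j - 1.
    under eq_bigr do rewrite !mxE eqxx /=.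
    rewrite sumrB; congr (_ - _); rewrite (bigD1 i) //= eqxx big1 ?addr0 //.
    by move=> j /negPf ->.
  lia.
- by rewrite topple_fire.
exists (i :: s); first by rewrite /= ci.
move: hb; rewrite /topple /script big_cons mulmxDl -rowE opprD addrA.
exact.
Qed.

Lemma recurrent_unique_below {n} {Delta : 'M[int]_n} {u v w : 'rV[int]_n} :
  \det Delta != 0 -> Zmatrix Delta ->
  transforms Delta (u + v *m Delta) u ->
  vnonneg w -> vnonneg (v - w) -> below_diag Delta (u + w *m Delta) -> w = 0.
Proof.
move=> hdet hoff [s hs hu] w0 vw hw.
(* Nonsingularity determines how often each vertex topples. *)
have vs : v = script s.
  apply: (mulmx_row_inj _ _ _ hdet); rewrite script_mul.
  by apply: (addrI u); rewrite {2}hu subrK.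
have hvw : below_diag Delta (u + v *m Delta - (v - w) *m Delta).
  by rewrite mulmxBl opprB addrA addrAC addrK addrC addrC.
(* Firing [v - w] ends at [u + w *m Delta], so [script s = v] is at most [v - w], that is
   [w <= 0]. *)
have h := least_action hoff vw hvw hs.
apply/rowP => i; apply/eqP; rewrite [X in _ == X]mxE eq_le w0 andbT.
by have := h i; rewrite -vs addrAC subrr add0r mxE oppr_ge0.
Qed.

Lemma transforms_of_unique_below {n} {Delta : 'M[int]_n} {u r : 'rV[int]_n} :
  Zmatrix Delta -> vnonneg r -> below_diag Delta u ->
  (forall w, vnonneg w -> vnonneg (r - w) ->
     below_diag Delta (u + w *m Delta) -> w = 0) ->
  transforms Delta (u + r *m Delta) u.
Proof.
move=> hoff r0 hu huniq.
have hr : below_diag Delta (u + r *m Delta - r *m Delta) by rewrite addrK.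
have [s hs hb] := stabilization_exists hoff r0 hr.
exists s => //; rewrite -script_mul.
(* The stabilization reached is [u + (r - script s) *m Delta], so the unfired part of [r] is itself
   an admissible [w]. *)
have /eqP : r - script s = 0.
  apply: huniq; first exact: (least_action hoff r0 hr hs).
    rewrite opprB addrC subrK => i.
    rewrite /script summxE sumr_ge0 // => j _; rewrite mxE.
    exact: ler0n.
  by rewrite mulmxBl addrA.
by rewrite subr_eq0 => /eqP <-; rewrite addrK.
Qed.

Lemma exists_muln_ge {n} {r : 'rV[int]_n} (r' : 'rV[int]_n) :
  vpos r -> vpos r' -> exists k : nat, vnonneg (r *+ k - r').
Proof.
(* One [k] above all entries of [r'] suffices, since the positive integers [r_i] are at least 1. *)
move=> r0 r'0; exists (\sum_i `|r' 0%R i|)%N => i.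
rewrite mxE mulmxnE mxE subr_ge0.
have hi : (`|r' 0%R i| <= \sum_j `|r' 0%R j|)%N.
  by rewrite (bigD1 i) //= leq_addr.
have := r0 i; have := r'0 i; move: hi; move: (\sum_j _)%N => k hk h' h.
rewrite -mulr_natr natz; apply: (@le_trans _ _ k%:Z); last first.
  by rewrite ler_peMl // -gtz0_ge1.
by rewrite -[r' 0 i]gtz0_abs.
Qed.

Lemma recurrent_sub {n} {Delta : 'M[int]_n} {r r' : 'rV[int]_n} :
  \det Delta != 0 -> Zmatrix Delta -> scriptR Delta r -> scriptR Delta r' ->
  recurrent Delta r `<=` recurrent Delta r'.
Proof.
move=> hdet hoff [r0 rD] [r'0 _] u [su tu]; split => //.
have [k hk] := exists_muln_ge r' r0 r'0.
have tk : transforms Delta (u + (r *+ k) *m Delta) u.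
  by rewrite -[_ *m _]/(mulmxr Delta _) raddfMn; exact: transforms_muln.
apply: transforms_of_unique_below => //.
- by move=> i; exact/ltW/r'0.
- by move=> i; rewrite ltNge; exact: su.2.
(* Here [w <= r' <= r *+ k], so uniqueness for [r *+ k] covers [w]. *)
move=> w w0 wr' hw; apply: (recurrent_unique_below hdet hoff tk) => // i.
have -> : r *+ k - w = (r *+ k - r') + (r' - w) by rewrite addrA subrK.
by rewrite mxE addr_ge0.
Qed.

Theorem theorem3p5 (n : nat) (hn : (0 < n)%N) (Delta : 'M[int]_n)
  (hdet : \det Delta != 0)
  (hoff : forall i j : 'I_n, i != j -> Delta i j <= 0)
  (hr : exists r : 'rV[int]_n, vpos r /\ vnonneg (r *m Delta))
  (r r' : 'rV[int]_n) (r_in : scriptR Delta r) (r'_in : scriptR Delta r') :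
  recurrent Delta r = recurrent Delta r'.
Proof. by apply/seteqP; split; exact: recurrent_sub. Qed.
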